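(* Let $\mathbf{L}$ be an (irreducible) graph link with $r$ components whose graph has nodes $v_{r+1},\dots,v_{r+p}$. Then the Alexander norm of $\mathbf{L}$ can be expressed as a sum of the Alexander norms of the $p$ splice components of the graph: for every $\phi\in H^1(X;\mathbb{R})\cong\mathbb{R}^r$, $X$ the link exterior, $$\|\phi\|_A=\|\phi\|_{\mathrm{N}(\triangle^{\mathbf{L}}(t_1,\dots,t_r))}=\sum_{i=r+1}^{r+p}(\tilde\delta_i-2)\,\|\phi\|_{\mathrm{N}(t_1^{l_{1i}}\cdots t_r^{l_{ri}}-1)}=\sum_{i=1}^p\|\phi\|_A^i,$$ where $\|\phi\|_A^i$ denotes the contribution of the $i$-th splice component (the $i$-th term of the preceding sum), and $\tilde\delta_i=\delta_i-\sum_{k=1}^{q_i}\frac{1}{\alpha_k^i}$ with $q_i$ the number of boundary vertices attached to the node $v_i$ and $\alpha_k^i$ the weight at $v_i$ of the edge to its $k$-th boundary vertex.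
   Context: A Seifert link is a link in a homology 3-sphere with Seifert-fibered exterior, written $(\Sigma(\epsilon;\alpha_1,\dots,\alpha_n),S_1\cup\dots\cup S_s)$, where $\Sigma(\epsilon;\alpha_1,\dots,\alpha_n)$ is the Seifert-fibered homology 3-sphere with fibers of pairwise coprime multiplicities $\alpha_i$ and orientation $\epsilon=\pm1$, and $S_1,\dots,S_s$ are the first $s$ of the corresponding fibers. Its graph is a node of sign $\epsilon$ with $n\ge3$ edges weighted $\alpha_1,\dots,\alpha_n$, ending in arrowhead vertices for $S_1,\dots,S_s$ and in boundary vertices for the other fibers. Splicing two links along a component of each (remove open tubular neighborhoods and glue the boundary tori interchanging meridian and longitude) corresponds to joining the two arrowhead edges into one edge (keeping one weight at each end). A graph link is a Seifert link or a splice of two or more Seifert links in homology 3-spheres; it is irreducible if it is not a disjoint sum of links. Its graph is the minimal splice diagram, with nonnegative edge weights, boundary vertex edge weights at least $2$, and at least three edges at each node; it has $r$ arrowheads $v_1,\dots,v_r$, $p$ nodes $v_{r+1},\dots,v_{r+p}$ and $q$ boundary vertices $v_{r+p+1},\dots,v_{r+p+q}$. $\delta_i$ is the number of edges incident to $v_i$. The linking number $l_{ij}$ of distinct vertices is the product of the signs of all nodes on the simple path $\sigma_{ij}$ from $v_i$ to $v_j$ (endpoints included) times the product of all edge weights adjacent to these nodes but not on $\sigma_{ij}$. The splice components are the $p$ Seifert pieces corresponding to the nodes. The Alexander polynomial is given, up to units, by the Eisenbud–Neumann formula $\triangle^{\mathbf{L}}=\prod_{j=r+1}^{r+p+q}(t_1^{l_{1j}}\cdots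 t_r^{l_{rj}}-1)^{\delta_j-2}$; if $r=1$ the right-hand side has the additional factor $(t_1-1)$. Terms $(t_1^0\cdots t_r^0-1)^d$ are formally cancelled against each other before being set to zero. The Newton polyhedron $\mathrm{N}(f)$ of a Laurent polynomial $f$ is the convex hull of its exponents. For a Laurent polynomial $f$, $\|\phi\|_f=\sup_{\alpha,\beta\in\operatorname{supp}(f)}\phi(\alpha-\beta)$, with $\operatorname{supp}(f)$ the set of exponents with non-zero coefficient; for a polyhedron $P$, $\|\phi\|_P=\sup_{x,y\in P}\phi(x-y)$ (the width of $P$ in direction $\phi$), so $\|\phi\|_f=\|\phi\|_{\mathrm{N}(f)}$. The Alexander norm is $\|\phi\|_A=\|\phi\|_{\triangle^{\mathbf{L}}}$.
   Formalization: The Alexander polynomial is assumed non-zero (the equality fails when it vanishes), and for r=1 the term ‖φ‖_{N(t_1-1)} from the additional factor (t_1-1) is added to the sum, since the stated equality is false for knots such as the trefoil. *)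

(* Defs.v *)
(* first, because mpoly has its own [symmetric] *)
From mathcomp Require Import mpoly.
From mathcomp Require Import all_boot all_order all_algebra.
From mathcomp Require Import finmap monalg.
From mathcomp Require Import classical_sets reals.

Set Implicit Arguments.
Unset Strict Implicit.
Unset Printing Implicit Defensive.

Import Order.TTheory GRing.Theory Num.Theory.

Local Open Scope ring_scope.

(* The r arrowheads, p nodes and q boundary vertices of a splice diagram;
   [inr : 'I_p + 'I_q -> vertex r p q] embeds the non-arrowhead vertices. *)
Definition vertex (r p q : nat) : Type := ('I_r + ('I_p + 'I_q))%type.

Definition arrowhead {r p q} (i : 'I_r) : vertex r p q := inl i.
Definition node {r p q} (i : 'I_p) : vertex r p q := inr (inl i).
Definition boundary {r p q} (i : 'I_q) : vertex r p q := inr (inr i).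

(* A link is represented by its splice diagram: a tree, obtained by joining
   Seifert stars (one per node) along pairs of arrowhead edges.
   [weight i v] is the weight, at the i-th node, of the edge joining that node
   to v; it is only meaningful when this edge exists. A node-node edge thus
   carries one weight at each end. The weights at a node are the multiplicities
   of the fibers of a Seifert homology sphere, so they are pairwise coprime;
   the weight 0 is allowed. *)
Record splice_diagram (r p q : nat) := SpliceDiagram {
  adj : rel (vertex r p q);
  negative : pred 'I_p;
  weight : 'I_p -> vertex r p q -> nat;
  arrowhead_exists : (0 < r)%N;
  node_exists : (0 < p)%N;
  adj_sym : symmetric adj;
  adj_irr : irreflexive adj;
  adj_connected : forall u v, connect adj u v;
  (* size 2 is allowed: [ucycle] accepts [:: x; y] for every edge xy *)
  adj_acyclic : forall c, ucycle adj c -> (size c <= 2)%N;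
  degree_arrowhead : forall i, #|adj (arrowhead i)| = 1%N;
  degree_boundary : forall i, #|adj (boundary i)| = 1%N;
  degree_node : forall i, (3 <= #|adj (node i)|)%N;
  weight_coprime : forall i u v, adj (node i) u -> adj (node i) v -> u != v ->
    coprime (weight i u) (weight i v);
  weight_boundary : forall i b, adj (node i) (boundary b) ->
    (2 <= weight i (boundary b))%N
}.

Section Diagram.
Variables (r p q : nat) (G : splice_diagram r p q).
Implicit Types (u v x y : vertex r p q).

Definition degree v : nat := #|adj G v|.

Definition node_sign (i : 'I_p) : int := (-1) ^+ negative G i.

Definition is_simple_path u v (s : seq (vertex r p q)) : bool :=
  [&& path (adj G) u s, uniq (u :: s) & last u s == v].

Lemma simple_path_exists u v : exists s, is_simple_path u v s.
Proof.
have /connectP[s us ->] := adj_connected G u v.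
by case/shortenP: us => s' us' uniqs' _; exists s'; apply/and3P; split.
Qed.

(* The simple path sigma from u to v, without its first vertex u; the diagram
   being a tree, it is the only s with [is_simple_path u v s]. *)
Definition sigma u v : seq (vertex r p q) := xchoose (simple_path_exists u v).

Definition edge_on_sigma u v x y : bool :=
  let steps := zip (u :: sigma u v) (sigma u v) in
  ((x, y) \in steps) || ((y, x) \in steps).

Definition linking u v : int :=
  \prod_(i : 'I_p | node i \in u :: sigma u v)
     (node_sign i *
      \prod_(w | adj G (node i) w && ~~ edge_on_sigma u v (node i) w)
         (weight G i w)%:Z).

(* (l_{1v}, ..., l_{rv}) *)
Definition linking_vector v : 'rV[int]_r :=
  \row_(k < r) linking (arrowhead k) v.

Definition reduced_degree (R : realType) (i : 'I_p) : R :=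
  (degree (node i))%:R
  - \sum_(b : 'I_q | adj G (node i) (boundary b))
       ((weight G i (boundary b))%:R)^-1.

End Diagram.

(* Laurent polynomials in t_1, ..., t_r over the integers, as finitely supported
   families of coefficients indexed by exponents. Their multiplication is that
   of the field of rational functions, in which [eval_laurent] embeds them. *)
Notation laurent r := {malg int['rV[int]_r]}.

Definition ratfun (r : nat) : fieldType := {fraction (mpoly r int)}.

Definition tvar (r : nat) (i : 'I_r) : ratfun r :=
  tofrac (mpolyX int (mnm1 i)).

Definition tmonomial (r : nat) (a : 'rV[int]_r) : ratfun r :=
  \prod_(i < r) tvar i ^ a 0 i.

Definition eval_laurent (r : nat) (f : laurent r) : ratfun r :=
  \sum_(a <- msupp f) (mcoeff a f)%:~R * tmonomial a.

(* t_1^{a_1} ... t_r^{a_r} - 1 *)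
Definition tbinomial (r : nat) (a : 'rV[int]_r) : laurent r :=
  << 1 *g a >> - << 1 *g 0 >>.

(* The Eisenbud-Neumann product. The factors (t^0 - 1)^d are collected into a
   single power of t^0 - 1 = 0 before being evaluated: total exponent 0 gives 1,
   a positive one gives 0 (a negative one does not occur). When r = 1,
   [const_mx 1] is the exponent of t_1. *)
Definition eisenbud_neumann (r p q : nat) (G : splice_diagram r p q) :
    ratfun r :=
  let l (j : 'I_p + 'I_q) := linking_vector G (inr j) in
  let d (j : 'I_p + 'I_q) : int := (degree G (inr j))%:Z - 2 in
  (if r == 1%N then tmonomial (const_mx 1) - 1 else 1)
  * (tmonomial 0 - 1) ^ (\sum_(j | l j == 0) d j)
  * \prod_(j | l j != 0) (tmonomial (l j) - 1) ^ d j.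

(* The Alexander polynomial is defined up to the units +-t^a. *)
Definition is_alexander_polynomial (r p q : nat) (G : splice_diagram r p q)
    (D : laurent r) : Prop :=
  exists (s : bool) (a : 'rV[int]_r),
    eval_laurent D = (-1) ^+ s * tmonomial a * eisenbud_neumann G.

Section Norms.
Local Open Scope classical_set_scope.
Variables (R : realType) (r : nat).
Implicit Types (f : laurent r) (P : set 'rV[R]_r) (phi x y : 'rV[R]_r).

Definition exponent (a : 'rV[int]_r) : 'rV[R]_r := map_mx intr a.

(* phi in H^1(X; R) = R^r, as a linear form on the space of exponents *)
Definition pairing phi x : R := \sum_(i < r) phi 0 i * x 0 i.

Definition newton_polyhedron f : set 'rV[R]_r :=
  [set x | exists c : 'rV[int]_r -> R,
     [/\ forall a, 0 <= c a,
         \sum_(a <- msupp f) c a = 1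
       & x = \sum_(a <- msupp f) c a *: exponent a]].

(* For the zero polynomial, both suprema are over the empty set, hence 0. *)
Definition laurent_norm f phi : R :=
  sup [set z | exists a b, [/\ a \in msupp f, b \in msupp f
                             & z = pairing phi (exponent a - exponent b)]].

Definition width P phi : R :=
  sup [set z | exists x y, [/\ P x, P y & z = pairing phi (x - y)]].

Definition alexander_norm_component (p q : nat) (G : splice_diagram r p q)
    (i : 'I_p) phi : R :=
  (reduced_degree G R i - 2)
  * width (newton_polyhedron (tbinomial (linking_vector G (node i)))) phi.

End Norms.

(* Main.v *)
Require Import Defs.
From mathcomp Require Import finmap monalg mpoly.
From mathcomp Require Import all_boot all_order all_algebra.
From mathcomp Require Import classical_sets reals.
From mathcomp Require Import ring.

(** For a fixed direction phi, the maximum of phi over the exponents behaves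
    like minus a valuation: since the coefficients form a domain, the part of a
    product on which phi is largest is the product of the corresponding parts
    of the factors, so this maximum turns products into sums. Read on quotients
    of polynomials ([height], [heightM]), this also holds for negative powers,
    hence for the Eisenbud-Neumann product as an element of the field of
    rational functions. The sum of the heights for phi and -phi ([breadth])
    vanishes on the units +-t^a and is |phi(a)| on t^a - 1; on a nonzero Laurent
    polynomial it is the norm, which is also the width of the Newton polyhedron
    ([laurent_norm_breadth], [width_newton], [width_tbinomial]).

    Taking breadths in the Eisenbud-Neumann product gives the sum of
    (delta_j - 2) |phi(l_j)| over all nodes and boundary vertices j, where a
    boundary vertex contributes with the coefficient -1, and for r = 1 the
    additional term of t_1 - 1. The second ingredient removes the boundary
    vertices: each of them hangs on exactly one node i, by an edge of some
    weight alpha, and prolonging a path from an arrowhead to node i by this edge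
    only takes alpha out of the product of the weights off the path, so that
    l_i = alpha l_b ([linking_vector_boundary]). The uniqueness of simple paths
    in a tree is what identifies the prolonged path with sigma. Hence b
    contributes - |phi(l_i)| / alpha, and collecting these terms at node i
    replaces delta_i by the reduced degree. Vertices with zero linking vector
    have width zero on both sides; the power of t^0 - 1 = 0 that gathers them
    has exponent 0, since D is not zero. *)

Set Implicit Arguments.
Unset Strict Implicit.
Unset Printing Implicit Defensive.

Import Order.TTheory GRing.Theory Num.Theory.

Local Open Scope ring_scope.

(** * Simple paths in trees *)

Lemma mem_zip (S T : eqType) (s : seq S) (t : seq T) x y :
  (x, y) \in zip s t -> (x \in s) && (y \in t).
Proof.
elim: s t => [|z s IH] [|w t] //=; rewrite !inE xpair_eqE.
by case/orP=> [/andP [-> ->] //|/IH /andP [-> ->]]; rewrite !orbT.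
Qed.

Section Trees.
Variables (T : finType) (e : rel T).
Hypotheses (e_sym : symmetric e)
  (e_acyclic : forall c, ucycle e c -> (size c <= 2)%N).

(** The walks to the common end [last x s1] are glued, the second one reversed,
    and then shortened to a simple path. *)
Lemma path_avoiding u x y s1 s2 :
    path e x s1 -> path e y s2 -> last x s1 = last y s2 ->
    u \notin x :: s1 -> u \notin y :: s2 ->
  exists s, [/\ path e x s, uniq (x :: s), last x s = y & u \notin x :: s].
Proof.
move=> xs1 ys2 eq_last us1 us2.
pose s := s1 ++ rev (belast y s2).
have xs : path e x s.
  rewrite cat_path xs1 /= eq_last rev_path.
  by rewrite (eq_path (e' := e)) // => a b; rewrite e_sym.
have lasts : last x s = y.
  rewrite last_cat eq_last; case: (s2) => //= z s2'.
  by rewrite rev_cons last_rcons.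
have us : u \notin x :: s.
  rewrite -cat_cons mem_cat negb_or us1 mem_rev.
  by apply: contra us2 => /mem_belast.
case/shortenP: xs lasts => s' xs' uniqs' sub_s' lasts.
exists s'; split=> //; apply: contra us; rewrite !inE.
by case/predU1P=> [->|/sub_s' ->]; rewrite ?eqxx ?orbT.
Qed.

(** At the first vertex u where two simple paths diverge, to x and to y, their
    continuations join x to y without meeting u; closing this up at u gives a
    cycle with at least three vertices. *)
Lemma simple_path_unique u s1 s2 :
    path e u s1 -> uniq (u :: s1) -> path e u s2 -> uniq (u :: s2) ->
  last u s1 = last u s2 -> s1 = s2.
Proof.
elim: s1 u s2 => [|x s1 IH] u [|y s2] //=.
- by move=> _ _ _ /andP [us2 _] uE; rewrite uE mem_last in us2.
- by move=> _ /andP [us1 _] _ _ uE; rewrite -uE mem_last in us1.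
move=> /andP [ux xs1] /andP [us1 uniq1] /andP [uy ys2] /andP [us2 uniq2] eql.
have [xy|neq_xy] := eqVneq x y.
  by rewrite -xy in ys2 us2 uniq2 eql *; rewrite (IH x s2).
have [s [xs uniqs lasts us]] := path_avoiding xs1 ys2 eql us1 us2.
have /e_acyclic : ucycle e [:: u, x & s].
  by rewrite /ucycle /= ux rcons_path xs lasts e_sym uy us.
case: s {xs uniqs us} lasts => // xy _.
by rewrite -xy eqxx in neq_xy.
Qed.

End Trees.

(** * Linking numbers of boundary vertices *)

Section Diagram.
Variables (r p q : nat) (G : splice_diagram r p q).
Implicit Types (u v x y : vertex r p q).

Lemma sigmaP u v :
  [/\ path (adj G) u (sigma G u v), uniq (u :: sigma G u v)
    & last u (sigma G u v) = v].
Proof. by have /and3P [? ? /eqP ?] := xchooseP (simple_path_exists G u v). Qed.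

Lemma sigma_unique u v s : is_simple_path G u v s -> s = sigma G u v.
Proof.
have [us' uniqs' lasts'] := sigmaP u v.
case/and3P=> us uniqs /eqP lasts.
have unique := simple_path_unique (@adj_sym _ _ _ G) (@adj_acyclic _ _ _ G).
by apply: (unique _ _ _ us uniqs us' uniqs'); rewrite lasts.
Qed.

Lemma leaf_neighbour v x y :
  #|adj G v| = 1%N -> adj G v x -> adj G v y -> x = y.
Proof.
move/eqP/card1P => [z vz] vx vy.
have /eqP -> : x == z by rewrite -[_ == _]/(x \in pred1 z) -vz.
by apply/esym/eqP; rewrite -[_ == _]/(y \in pred1 z) -vz.
Qed.

(** The path to a node starts by the only edge at b. If its second vertex were
    another leaf, the path could only return to b. *)
Lemma boundary_attached (b : 'I_q) : exists i, adj G (node i) (boundary b).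
Proof.
pose n : vertex r p q := node (Ordinal (node_exists G)).
have [] := sigmaP (boundary b) n.
case: (sigma _ _ _) => // w s /= /andP [bw ws] /andP [bs _] lasts.
case: w => [k|[i|b']] in bw ws bs lasts *; last 2 first.
- by exists i; rewrite adj_sym.
- case: s lasts ws bs => // z s _ /= /andP [wz _].
  rewrite adj_sym in bw.
  by rewrite (leaf_neighbour (degree_boundary G b') bw wz) !inE eqxx !orbT.
case: s lasts ws bs => // z s _ /= /andP [wz _].
rewrite adj_sym in bw.
by rewrite (leaf_neighbour (degree_arrowhead G k) bw wz) !inE eqxx !orbT.
Qed.

Lemma sigma_boundary (k : 'I_r) i b : adj G (node i) (boundary b) ->
  sigma G (arrowhead k) (boundary b)
  = rcons (sigma G (arrowhead k) (node i)) (boundary b).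
Proof.
move=> ib; have [] := sigmaP (arrowhead k) (boundary b).
case/lastP: (sigma _ _ (boundary b)) => // s b'.
rewrite rcons_path last_rcons => /andP [ks sb] uniqs eqb.
rewrite eqb in sb uniqs *; congr rcons; apply: sigma_unique.
apply/and3P; split=> //.
  by move: uniqs; rewrite -rcons_cons rcons_uniq => /andP [].
apply/eqP; rewrite adj_sym in sb; rewrite adj_sym in ib.
exact: leaf_neighbour (degree_boundary G b) sb ib.
Qed.

Lemma zip_steps_rcons (T : Type) (u x : T) s :
  zip (u :: rcons s x) (rcons s x) = rcons (zip (u :: s) s) (last u s, x).
Proof. by elim: s u => //= y s IH u; rewrite IH. Qed.

Lemma edge_on_sigma_boundary (k : 'I_r) i b (j : 'I_p) w :
    adj G (node i) (boundary b) ->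
  edge_on_sigma G (arrowhead k) (boundary b) (node j) w
  = edge_on_sigma G (arrowhead k) (node i) (node j) w
    || (j == i) && (w == boundary b).
Proof.
move=> ib; have [_ _ lasti] := sigmaP (arrowhead k) (node i).
rewrite /edge_on_sigma (sigma_boundary k ib) zip_steps_rcons lasti.
rewrite !mem_rcons !inE !xpair_eqE.
have -> : (node j == node i :> vertex r p q) = (j == i) by [].
have -> : (node j == boundary b :> vertex r p q) = false by [].
by rewrite andbF /= -orbA orbC.
Qed.

(** Prolonging the path from node i to b visits no further node, and the only
    weight that leaves the product is that of the added edge at node i. *)
Lemma linking_boundary (k : 'I_r) i b : adj G (node i) (boundary b) ->
  linking G (arrowhead k) (node i)
  = (weight G i (boundary b))%:Z * linking G (arrowhead k) (boundary b).
Proof.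
move=> ib; have [_ _ lasti] := sigmaP (arrowhead k) (node i).
have [_ uniqb _] := sigmaP (arrowhead k) (boundary b).
have i_in : node i \in arrowhead k :: sigma G (arrowhead k) (node i).
  by rewrite -{1}lasti mem_last.
have b_off : ~~ edge_on_sigma G (arrowhead k) (node i) (node i) (boundary b).
  move: uniqb; rewrite (sigma_boundary k ib) -rcons_cons rcons_uniq.
  case/andP=> b_notin _; rewrite /edge_on_sigma.
  by apply: contra b_notin => /orP [] /mem_zip /andP [in1 in2].
(* isolate node i, then the weight of its edge to b on the left-hand side *)
rewrite /linking (bigD1 i) //= [in RHS](bigD1 i) /=; last first.
  by rewrite (sigma_boundary k ib) -rcons_cons mem_rcons inE i_in orbT.
rewrite (bigD1 (boundary b)) ?ib ?b_off //= mulrA [node_sign G i * _]mulrC.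
rewrite -!mulrA; congr (_ * (_ * (_ * _))).
  apply: eq_bigl => w; rewrite (edge_on_sigma_boundary _ _ _ ib) eqxx /=.
  by rewrite negb_or andbA.
apply: eq_big => [j|j /andP [_ /negPf ji]].
  by rewrite (sigma_boundary k ib) -rcons_cons mem_rcons inE.
congr (_ * _); apply: eq_bigl => w.
by rewrite (edge_on_sigma_boundary _ _ _ ib) ji orbF.
Qed.

Lemma linking_vector_boundary i b : adj G (node i) (boundary b) ->
  linking_vector G (node i)
  = linking_vector G (boundary b) *+ weight G i (boundary b).
Proof.
move=> ib; apply/rowP => k; rewrite mulmxnE !mxE (linking_boundary k ib).
by rewrite -natz mulr_natl.
Qed.

End Diagram.

(** * Maxima over finite families *)

Section Suprema.
Local Open Scope classical_set_scope.
Variable R : realType.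

Lemma sup_attained (E : set R) x : E x -> ubound E x -> sup E = x.
Proof.
move=> Ex ubx; apply: le_anti; rewrite ge_sup //=; last by exists x.
by apply: ub_le_sup => //; exists x.
Qed.

Lemma seq_max_exists (T : eqType) (s : seq T) (f : T -> R) :
  s != [::] -> exists2 x, x \in s & {in s, forall y, f y <= f x}.
Proof.
elim: s => // x s IH _; have [->|/IH [y ys ymax]] := eqVneq s [::].
  by exists x; rewrite ?mem_head // => y; rewrite inE => /eqP ->.
have [le_xy|/ltW le_yx] := leP (f x) (f y).
  exists y; first by rewrite inE ys orbT.
  by move=> z; rewrite inE => /predU1P [->|/ymax].
exists x; first exact: mem_head.
move=> z; rewrite inE => /predU1P [->//|/ymax le_zy].
exact: le_trans le_zy le_yx.
Qed.

End Suprema.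

(** * The height of a polynomial in a given direction *)

Section PolynomialHeight.
Variables (R : realType) (r : nat) (phi : 'rV[R]_r).
Implicit Types (P Q : mpoly r int) (m : 'X_{1..r}).

Definition monomial_height m : R := \sum_(i < r) phi 0 i * (m i)%:R.

Lemma monomial_heightD m1 m2 :
  monomial_height (m1 + m2)%MM = monomial_height m1 + monomial_height m2.
Proof.
by rewrite -big_split; apply: eq_bigr => i _; rewrite mnmDE natrD mulrDr.
Qed.

Definition poly_height P : R :=
  sup [set monomial_height m | m in [set` msupp P]]%classic.

Lemma poly_heightP P m :
    m \in msupp P ->
    {in msupp P, forall m', monomial_height m' <= monomial_height m} ->
  poly_height P = monomial_height m.
Proof.
by move=> mP mmax; apply: sup_attained => [|_ [m' /= m'P <-]];
  [exists m | apply: mmax].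
Qed.

Lemma poly_height_attained P : P != 0 ->
  exists2 m, m \in msupp P & poly_height P = monomial_height m.
Proof.
rewrite -msupp_eq0 => /seq_max_exists -/(_ _ monomial_height) [m mP mmax].
by exists m => //; apply: poly_heightP.
Qed.

Lemma monomial_height_le P m :
  m \in msupp P -> monomial_height m <= poly_height P.
Proof.
move=> mP; have /seq_max_exists -/(_ _ monomial_height) [n nP nmax] :
  msupp P != [::] by apply: contraTneq mP => ->.
by rewrite (poly_heightP nP nmax) nmax.
Qed.

(** The face of P in the direction phi. *)
Definition top_form P : mpoly r int :=
  \sum_(m <- msupp P | monomial_height m == poly_height P) P@_m *: 'X_[m].

Lemma mcoeff_top_form P m :
  (top_form P)@_m = if monomial_height m == poly_height P then P@_m else 0.
Proof.
rewrite [top_form P]big_mkcond raddf_sum /=.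
have [mP|mP] := boolP (m \in msupp P); last first.
  rewrite (memN_msupp_eq0 mP) if_same big_seq big1 // => n nP.
  case: ifP => _; last by rewrite raddf0.
  rewrite mcoeffZ mcoeffX; case: eqP nP mP => [->->//|_ _ _].
  by rewrite mulr0.
rewrite (bigD1_seq m) //= big1 => [|n neq]; last first.
  by case: ifP => _; rewrite ?raddf0 // mcoeffZ mcoeffX (negPf neq) mulr0.
case: ifP => _; last by rewrite raddf0 addr0.
by rewrite mcoeffZ mcoeffX eqxx mulr1 addr0.
Qed.

Lemma top_form_neq0 P : P != 0 -> top_form P != 0.
Proof.
case/poly_height_attained=> m mP hm; apply: contraTneq mP => P0.
have := mcoeff_top_form P m.
by rewrite P0 hm eqxx mcoeff0 mcoeff_msupp negbK => <-.
Qed.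

Lemma top_form_height P m :
  m \in msupp (top_form P) -> monomial_height m = poly_height P.
Proof.
by rewrite mcoeff_msupp mcoeff_top_form; case: ifP => [/eqP //|_]; rewrite eqxx.
Qed.

Lemma top_formB_height P m :
  m \in msupp (P - top_form P) -> monomial_height m < poly_height P.
Proof.
rewrite mcoeff_msupp mcoeffB mcoeff_top_form; case: ifP => [_|/negbT neq].
  by rewrite subrr eqxx.
by rewrite subr0 -mcoeff_msupp lt_neqAle neq => /monomial_height_le.
Qed.

(** The product of the top forms is nonzero and is the part of P * Q of height
    [poly_height P + poly_height Q]: all other products of terms are lower, so
    nothing can cancel it. *)
Lemma poly_heightM P Q : P != 0 -> Q != 0 ->
  poly_height (P * Q) = poly_height P + poly_height Q.
Proof.
move=> P0 Q0.
have TT0 : top_form P * top_form Q != 0 by rewrite mulf_neq0 ?top_form_neq0.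
have [m mTT _] := poly_height_attained TT0.
have hm : monomial_height m = poly_height P + poly_height Q.
  have /allpairsP [[m1 m2] /= [m1P m2Q ->]] := msuppM_le mTT.
  by rewrite monomial_heightD (top_form_height m1P) (top_form_height m2Q).
have c1 : (top_form P * (Q - top_form Q))@_m = 0.
  apply/memN_msupp_eq0/negP => /msuppM_le /allpairsP [[m1 m2] /=] [m1P m2Q mE].
  have := top_formB_height m2Q.
  rewrite -(ltrD2l (poly_height P)) -{1}(top_form_height m1P).
  by rewrite -monomial_heightD -mE hm ltxx.
have c2 : ((P - top_form P) * Q)@_m = 0.
  apply/memN_msupp_eq0/negP => /msuppM_le /allpairsP [[m1 m2] /=] [m1P m2Q mE].
  have := ltr_leD (top_formB_height m1P) (monomial_height_le m2Q).
  by rewrite -monomial_heightD -mE hm ltxx.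
have coefm : (P * Q)@_m = (top_form P * top_form Q)@_m.
  have -> : P * Q = top_form P * top_form Q + top_form P * (Q - top_form Q)
                    + (P - top_form P) * Q by ring.
  by rewrite mcoeffD c2 mcoeffD c1 !addr0.
rewrite -hm; apply: poly_heightP.
  by rewrite mcoeff_msupp coefm -mcoeff_msupp.
move=> _ /msuppM_le /allpairsP [[m1 m2] /= [m1P m2Q ->]].
by rewrite monomial_heightD hm lerD ?monomial_height_le.
Qed.

Lemma poly_heightX m : poly_height 'X_[m] = monomial_height m.
Proof.
apply: poly_heightP => [|m']; first by rewrite mcoeff_msupp mcoeffX eqxx.
by rewrite msuppX inE => /eqP ->.
Qed.

End PolynomialHeight.

(** * The height of a rational function *)

Section FractionHeight.
Variables (R : realType) (r : nat).
Implicit Types (phi : 'rV[R]_r) (F G : ratfun r) (P Q : mpoly r int).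

Lemma fraction_numden (K : idomainType) (F : {fraction K}) :
  F = tofrac (\n_(repr F)) / tofrac (\d_(repr F)).
Proof.
have dF0 := denom_ratioP (repr F).
apply: (canRL (mulfK _)); first by rewrite tofrac_eq0.
rewrite -{1}[F]reprK; unlock FracField.tofrac; rewrite -[LHS]FracField.pi_mul.
apply/eqmodP; rewrite /= FracField.equivfE /FracField.mulf.
by rewrite ?numden_Ratio ?(oner_neq0, mulf_neq0) // !mulr1 mulrC.
Qed.

Lemma tofrac_cross (K : idomainType) (a b c d : K) : b != 0 -> d != 0 ->
  tofrac a / tofrac b = tofrac c / tofrac d -> a * d = c * b.
Proof.
move=> b0 d0 /eqP; rewrite eqr_div ?tofrac_eq0 //.
by rewrite -!tofracM tofrac_eq => /eqP.
Qed.

Definition height phi F : R :=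
  poly_height phi (\n_(repr F)) - poly_height phi (\d_(repr F)).

(** Additivity on products makes the height independent of the fraction chosen
    to represent a rational function. *)
Lemma height_frac phi P Q : P != 0 -> Q != 0 ->
  height phi (tofrac P / tofrac Q) = poly_height phi P - poly_height phi Q.
Proof.
move=> P0 Q0; rewrite /height; set F := tofrac P / _.
have D0 := denom_ratioP (repr F).
have := tofrac_cross Q0 D0 (fraction_numden F).
move: (\n_ _) (\d_ _) D0 => N D D0 PDNQ.
have N0 : N != 0.
  apply: contraTneq (mulf_neq0 P0 D0) => N0.
  by rewrite PDNQ N0 mul0r eqxx.
have /(congr1 (poly_height phi)) := PDNQ; rewrite !poly_heightM // => hE.
apply/eqP; rewrite subr_eq addrAC eq_sym subr_eq; apply/eqP.
by rewrite hE.
Qed.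

Lemma heightM phi F G : F != 0 -> G != 0 ->
  height phi (F * G) = height phi F + height phi G.
Proof.
rewrite [F]fraction_numden [G]fraction_numden.
move: (denom_ratioP (repr F)) (denom_ratioP (repr G)).
move: (\n_ _) (\d_ _) (\n_ _) (\d_ _) => N D N' D' D0 D'0.
rewrite !mulf_eq0 !invr_eq0 !tofrac_eq0 !negb_or => /andP [N0 _] /andP [N'0 _].
rewrite mulf_div -!tofracM !height_frac ?mulf_neq0 // !poly_heightM //.
by rewrite opprD addrACA.
Qed.

Lemma height1 phi : height phi 1 = 0.
Proof.
by apply: (addrI (height phi 1)); rewrite -heightM ?oner_neq0 // mulr1 addr0.
Qed.

Lemma heightV phi F : F != 0 -> height phi F^-1 = - height phi F.
Proof.
move=> F0; apply: (addrI (height phi F)).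
by rewrite -heightM ?invr_eq0 // mulfV // height1 subrr.
Qed.

Lemma height_exp phi F (k : int) :
  F != 0 -> height phi (F ^ k) = height phi F *~ k.
Proof.
move=> F0; have hX n : height phi (F ^+ n) = height phi F *+ n.
  elim: n => [|n IH]; first by rewrite expr0 height1.
  by rewrite exprS heightM ?expf_neq0 // IH mulrS.
case: k => n; first exact: hX.
by rewrite NegzE -exprnN heightV ?expf_neq0 // hX mulrNz.
Qed.

Lemma height_prod phi (I : finType) (p : pred I) (F : I -> ratfun r) :
    (forall i, p i -> F i != 0) ->
  height phi (\prod_(i | p i) F i) = \sum_(i | p i) height phi (F i).
Proof.
move=> F0; have [//] : \prod_(i | p i) F i != 0 /\
  height phi (\prod_(i | p i) F i) = \sum_(i | p i) height phi (F i).
elim/big_rec2: _ => [|i h G pi [G0 <-]]; first by rewrite oner_neq0 height1.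
by rewrite heightM ?mulf_neq0 ?F0.
Qed.

Lemma height_sign phi (s : bool) : height phi ((-1) ^+ s) = 0.
Proof.
have s0 : (-1) ^+ s != 0 :> ratfun r by rewrite signr_eq0.
have /eqP : height phi ((-1) ^+ s) + height phi ((-1) ^+ s) = 0.
  by rewrite -heightM // -expr2 sqrr_sign height1.
by rewrite -mulr2n mulrn_eq0 => /eqP.
Qed.

End FractionHeight.

(** * Laurent polynomials as rational functions *)

Section LaurentEvaluation.
Variable r : nat.
Implicit Types (a b : 'rV[int]_r) (m n : 'X_{1..r}) (f : laurent r).

Lemma tvar_neq0 (i : 'I_r) : tvar i != 0.
Proof.
by rewrite /tvar tofrac_eq0 -msupp_eq0 msuppX.
Qed.

Lemma tmonomial_neq0 a : tmonomial a != 0.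
Proof.
by rewrite prodf_seq_neq0; apply/allP => i _; rewrite expfz_neq0 ?tvar_neq0.
Qed.

Lemma tmonomial0 : tmonomial (0 : 'rV[int]_r) = 1.
Proof. by rewrite /tmonomial big1 // => i _; rewrite mxE expr0z. Qed.

Lemma tmonomialD a b : tmonomial (a + b) = tmonomial a * tmonomial b.
Proof.
rewrite -big_split; apply: eq_bigr => i _.
by rewrite mxE expfzDr ?tvar_neq0.
Qed.

Definition nat_exponent m : 'rV[int]_r := \row_i (m i)%:Z.

Lemma nat_exponent_inj : injective nat_exponent.
Proof.
move=> m n /rowP eq_mn; apply/mnmP => i.
by have := eq_mn i; rewrite !mxE => -[].
Qed.

Lemma tmonomial_nat m : tmonomial (nat_exponent m) = tofrac (mpolyX int m).
Proof.
rewrite mpolyXE_id rmorph_prod; apply: eq_bigr => i _.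
by rewrite mxE -exprnP rmorphXn.
Qed.

Lemma tofrac_mpolyC (c : int) : tofrac (mpolyC r c) = c%:~R.
Proof. by rewrite -{1}(intz c) !rmorph_int. Qed.

(** A common monomial denominator: f is t^{-n} times a polynomial P whose
    coefficients are those of f, shifted by n. The relation between the
    coefficients transports supports, hence heights, between f and P. *)
Lemma eval_laurent_frac f : exists n (P : mpoly r int),
  [/\ eval_laurent f = tofrac P / tofrac (mpolyX int n),
      forall m, mcoeff m P = monalg.mcoeff (nat_exponent m - nat_exponent n) f
    & forall a, a \in monalg.msupp f ->
        exists m, a = nat_exponent m - nat_exponent n].
Proof.
(* large enough to make a + n nonnegative for every exponent a of f *)
pose n : 'X_{1..r} :=
  [multinom (\sum_(a <- monalg.msupp f) absz (a 0%R i))%N | i < r].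
pose num a : 'X_{1..r} := [multinom absz (a 0 i + (n i)%:Z)%R | i < r].
have numE a : a \in monalg.msupp f -> nat_exponent (num a) = a + nat_exponent n.
  move=> af; apply/rowP => i; rewrite !mxE mnmE gez0_abs //.
  have le_an : (absz (a 0%R i) <= n i)%N.
    by rewrite mnmE (big_rem a) //= leq_addr.
  by rewrite -lerBlDl sub0r (le_trans (ler_norm _)) // normrN -abszE lez_nat.
pose P : mpoly r int :=
  \sum_(a <- monalg.msupp f) monalg.mcoeff a f *: mpolyX int (num a).
exists n, P; split.
- apply: (canRL (mulfK _)); first by rewrite -tmonomial_nat tmonomial_neq0.
  rewrite rmorph_sum mulr_suml -tmonomial_nat big_seq [RHS]big_seq.
  apply: eq_bigr => a af; rewrite -mulrA -tmonomialD -numE // tmonomial_nat.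
  by rewrite -mul_mpolyC rmorphM /= tofrac_mpolyC.
- move=> m; rewrite raddf_sum /=.
  have coefE a : a \in monalg.msupp f ->
      mcoeff m (monalg.mcoeff a f *: mpolyX int (num a))
      = monalg.mcoeff a f *+ (a == nat_exponent m - nat_exponent n).
    move=> af; rewrite mcoeffZ mcoeffX mulr_natr; congr (_ *+ _).
    by rewrite -(inj_eq nat_exponent_inj) numE // eq_sym -subr_eq eq_sym.
  rewrite big_seq (eq_bigr _ coefE) -big_seq.
  have [bf|bf] := monalg.msuppP f (nat_exponent m - nat_exponent n).
    rewrite (bigD1_seq _ bf) ?fset_uniq //= eqxx big1 ?addr0 // => a.
    by move/negPf->.
  rewrite big_seq big1 // => a af; case: eqP => // aE.
  by rewrite aE (negPf bf) in af.
- by move=> a /numE numaE; exists (num a); rewrite numaE addrK.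
Qed.

End LaurentEvaluation.

(** * Norms, widths and breadths *)

Section Norms.
Variables (R : realType) (r : nat).
Implicit Types (phi x y : 'rV[R]_r) (f : laurent r) (F G : ratfun r).
Implicit Types (a b : 'rV[int]_r).

Lemma pairingD phi x y : pairing phi (x + y) = pairing phi x + pairing phi y.
Proof.
by rewrite -big_split; apply: eq_bigr => i _; rewrite mxE mulrDr.
Qed.

Lemma pairingZ phi c x : pairing phi (c *: x) = c * pairing phi x.
Proof.
by rewrite [RHS]mulr_sumr; apply: eq_bigr => i _; rewrite mxE mulrCA.
Qed.

Lemma pairingNr phi x : pairing phi (- x) = - pairing phi x.
Proof. by rewrite -scaleN1r pairingZ mulN1r. Qed.

Lemma pairingNl phi x : pairing (- phi) x = - pairing phi x.
Proof. by rewrite -[RHS]sumrN; apply: eq_bigr => i _; rewrite mxE mulNr. Qed.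

Lemma pairing0 phi : pairing phi 0 = 0.
Proof. by rewrite -(scale0r 0) pairingZ mul0r. Qed.

Lemma pairingB phi x y : pairing phi (x - y) = pairing phi x - pairing phi y.
Proof. by rewrite pairingD pairingNr. Qed.

Lemma monomial_height_pairing phi m :
  monomial_height phi m = pairing phi (exponent R (nat_exponent m)).
Proof. by apply: eq_bigr => i _; rewrite !mxE. Qed.

Lemma exponentB a b : exponent R (a - b) = exponent R a - exponent R b.
Proof. exact: map_mxB. Qed.

Lemma laurent_msupp_eq0 f : (monalg.msupp f == fset0) = (f == 0).
Proof.
apply/eqP/eqP => [f0|->]; last exact: monalg.msupp0.
by apply/monalg.malgP => a; rewrite monalg.mcoeff0 monalg.mcoeff_outdom // f0.
Qed.

Lemma eval_laurent_neq0 f : f != 0 -> eval_laurent f != 0.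
Proof.
rewrite -laurent_msupp_eq0 => /fset0Pn [a af].
have [n [P [-> Pf /(_ a af) [m am]]]] := eval_laurent_frac f.
rewrite mulf_neq0 // ?invr_eq0 -?tmonomial_nat ?tmonomial_neq0 // tofrac_eq0.
apply: contraTneq af => P0.
by rewrite am -monalg.mcoeff_neq0 -Pf P0 mcoeff0 eqxx.
Qed.

Lemma height_eval phi f a :
    a \in monalg.msupp f ->
    {in monalg.msupp f, forall b,
       pairing phi (exponent R b) <= pairing phi (exponent R a)} ->
  height phi (eval_laurent f) = pairing phi (exponent R a).
Proof.
move=> af amax; have [n [P [-> Pf ex]]] := eval_laurent_frac f.
have [m am] := ex a af.
have suppP k :
    (k \in msupp P) = (nat_exponent k - nat_exponent n \in monalg.msupp f).
  by rewrite mcoeff_msupp Pf monalg.mcoeff_neq0.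
have mP : m \in msupp P by rewrite suppP -am.
have P0 : P != 0 by rewrite -msupp_eq0; apply: contraTneq mP => ->.
have X0 : mpolyX int n != 0.
  by rewrite -tofrac_eq0 -tmonomial_nat tmonomial_neq0.
rewrite height_frac // (poly_heightP mP) => [|k].
  by rewrite poly_heightX !monomial_height_pairing -pairingB -exponentB am.
rewrite suppP => /amax; rewrite am !exponentB !pairingB lerD2r.
by rewrite !monomial_height_pairing.
Qed.

(** On a Laurent polynomial this is the maximum of phi over the exponents minus
    its minimum, the latter being minus the maximum of -phi. *)
Definition breadth phi F : R := height phi F + height (- phi) F.

Lemma extremal_exponents phi f : f != 0 -> exists a b,
  [/\ a \in monalg.msupp f, b \in monalg.msupp f
    & {in monalg.msupp f, forall c,
         pairing phi (exponent R b) <= pairing phi (exponent R c)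
         <= pairing phi (exponent R a)}].
Proof.
rewrite -laurent_msupp_eq0 => f0.
have {}f0 : enum_fset (monalg.msupp f) != [::].
  apply: contraNneq f0 => f0; apply/eqP/fsetP => a.
  by rewrite inE [_ \in _](congr1 (fun s => a \in s) f0).
have [a af amax] := seq_max_exists (fun a => pairing phi (exponent R a)) f0.
have [b bf bmin] := seq_max_exists (fun a => - pairing phi (exponent R a)) f0.
exists a, b; split=> // c cf; rewrite amax // andbT -lerN2.
exact: bmin.
Qed.

Lemma laurent_norm_breadth phi f :
  f != 0 -> laurent_norm f phi = breadth phi (eval_laurent f).
Proof.
case/(extremal_exponents phi) => a [b [af bf ext]].
rewrite /breadth (height_eval af) => [|c /ext /andP [] //].
rewrite (height_eval bf) => [|c /ext /andP [ge_b _]]; last first.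
  by rewrite !pairingNl lerN2.
rewrite pairingNl -pairingB; apply: sup_attained; first by exists a, b.
move=> _ [c [d [/ext /andP [_ le_ca] /ext /andP [le_bd _] ->]]].
by rewrite !pairingB lerB.
Qed.

(** The linear form phi takes its extrema over the polytope at exponents of f:
    its value at a convex combination lies between those at two of them. Both
    sides are suprema of the empty set when f is zero. *)
Lemma width_newton phi f : width (newton_polyhedron f) phi = laurent_norm f phi.
Proof.
have [->|f0] := eqVneq f 0.
  congr (sup _); apply/seteqP; split=> z.
    case=> x [y [[c [_ + _]] _ _]]; rewrite monalg.msupp0 big_seq_fset0.
    by move/eqP; rewrite eq_sym oner_eq0.
  by case=> a [b []]; rewrite monalg.msupp0.
have [a [b [af bf ext]]] := extremal_exponents phi f0.
have vertex c : c \in monalg.msupp f -> newton_polyhedron f (exponent R c).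
  move=> cf; exists (fun d => (d == c)%:R); split=> [d||].
  - exact: ler0n.
  - rewrite (bigD1_seq c) ?fset_uniq //= eqxx big1 ?addr0 // => d.
    by move/negPf->.
  rewrite (bigD1_seq c) ?fset_uniq //= eqxx scale1r big1 ?addr0 // => d.
  by move/negPf->; rewrite scale0r.
have hull x : newton_polyhedron f x ->
    pairing phi (exponent R b) <= pairing phi x <= pairing phi (exponent R a).
  case=> c [c0 c1 ->].
  have -> : pairing phi (\sum_(d <- monalg.msupp f) c d *: exponent R d)
            = \sum_(d <- monalg.msupp f) c d * pairing phi (exponent R d).
    elim/big_rec2: _ => [|d z x' _ <-]; first exact: pairing0.
    by rewrite pairingD pairingZ.
  rewrite -[pairing phi (exponent R b)]mul1r -[pairing phi (exponent R a)]mul1r.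
  rewrite -c1 !mulr_suml; apply/andP; split; rewrite big_seq [leRHS]big_seq;
    apply: ler_sum => d /ext /andP [le_bd le_da]; exact: ler_wpM2l.
rewrite (laurent_norm_breadth _ f0) /breadth (height_eval af); last first.
  by move=> c /ext /andP [].
rewrite (height_eval bf) => [|c /ext /andP [ge_b _]]; last first.
  by rewrite !pairingNl lerN2.
rewrite pairingNl -pairingB; apply: sup_attained.
  by exists (exponent R a), (exponent R b); split=> //; apply: vertex.
move=> _ [x [y [/hull /andP [_ le_xa] /hull /andP [le_by _] ->]]].
by rewrite !pairingB lerB.
Qed.

Lemma breadthM phi F G : F != 0 -> G != 0 ->
  breadth phi (F * G) = breadth phi F + breadth phi G.
Proof. by move=> F0 G0; rewrite /breadth !heightM // addrACA. Qed.

Lemma breadth_exp phi F (k : int) :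
  F != 0 -> breadth phi (F ^ k) = breadth phi F *~ k.
Proof. by move=> F0; rewrite /breadth !height_exp // -mulrzDl. Qed.

Lemma breadth_prod phi (I : finType) (p : pred I) (F : I -> ratfun r) :
    (forall i, p i -> F i != 0) ->
  breadth phi (\prod_(i | p i) F i) = \sum_(i | p i) breadth phi (F i).
Proof. by move=> F0; rewrite /breadth !height_prod // -big_split. Qed.

Lemma breadth1 phi : breadth phi 1 = 0.
Proof. by rewrite /breadth !height1 addr0. Qed.

Lemma eval_laurent_monomial a : eval_laurent (monalg.mkmalgU a 1) = tmonomial a.
Proof.
rewrite /eval_laurent monalg.msuppU oner_eq0 big_seq_fset1.
by rewrite monalg.mcoeffUU mul1r.
Qed.

Lemma breadth_tmonomial phi a : breadth phi (tmonomial a) = 0.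
Proof.
have suppa : monalg.msupp (monalg.mkmalgU a (1 : int)) = [fset a]%fset.
  by rewrite monalg.msuppU oner_eq0.
rewrite -eval_laurent_monomial /breadth !(@height_eval _ _ a) ?suppa ?inE //.
- by rewrite pairingNl subrr.
- by move=> b; rewrite inE => /eqP ->.
- by move=> b; rewrite inE => /eqP ->.
Qed.

Lemma msupp_tbinomial a :
  a != 0 -> monalg.msupp (tbinomial a) = [fset a; 0]%fset.
Proof.
move=> a0; apply/fsetP => b; rewrite -monalg.mcoeff_neq0 monalg.mcoeffB.
rewrite !monalg.mcoeffU !inE ![_ == b]eq_sym.
have [->|_] := eqVneq b a; first by rewrite (negPf a0) subr0.
by case: (b == 0).
Qed.

Lemma tbinomial_neq0 a : a != 0 -> tbinomial a != 0.
Proof.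
move=> a0; rewrite -laurent_msupp_eq0 msupp_tbinomial //.
by apply/fset0Pn; exists a; rewrite !inE eqxx.
Qed.

Lemma eval_tbinomial a : a != 0 -> eval_laurent (tbinomial a) = tmonomial a - 1.
Proof.
move=> a0; rewrite /eval_laurent msupp_tbinomial // big_fsetU1 ?inE //=.
rewrite big_seq_fset1 !monalg.mcoeffB !monalg.mcoeffU !eqxx.
by rewrite (negPf a0) eq_sym (negPf a0) subr0 sub0r mul1r tmonomial0 mulN1r.
Qed.

Lemma width_tbinomial phi a :
  width (newton_polyhedron (tbinomial a)) phi = `|pairing phi (exponent R a)|.
Proof.
rewrite width_newton; have [->|a0] := eqVneq a 0.
  have -> : tbinomial (0 : 'rV[int]_r) = 0 by exact: subrr.
  rewrite /exponent map_mx0 pairing0 normr0 -[RHS]sup0; congr (sup _).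
  by apply/seteqP; split=> // z [b [c []]]; rewrite monalg.msupp0.
have exponent0 : exponent R (0 : 'rV[int]_r) = 0 by exact: map_mx0.
apply: sup_attained; last first.
  move=> _ [b [c [+ + ->]]]; rewrite msupp_tbinomial // !inE.
  move=> /orP [] /eqP -> /orP [] /eqP ->; rewrite ?subrr ?pairing0 //.
    by rewrite exponent0 subr0 ler_norm.
  by rewrite exponent0 sub0r pairingNr -normrN ler_norm.
have [_|_] := ger0P (pairing phi (exponent R a)).
  exists a, 0; rewrite msupp_tbinomial // !inE !eqxx orbT; split=> //.
  by rewrite exponent0 subr0.
exists 0, a; rewrite msupp_tbinomial // !inE !eqxx orbT; split=> //.
by rewrite exponent0 sub0r pairingNr.
Qed.

Lemma breadth_binomial phi a : a != 0 ->
  breadth phi (tmonomial a - 1) = width (newton_polyhedron (tbinomial a)) phi.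
Proof.
move=> a0; rewrite width_newton laurent_norm_breadth ?tbinomial_neq0 //.
by rewrite eval_tbinomial.
Qed.

Lemma binomial_neq0 a : a != 0 -> tmonomial a - 1 != 0.
Proof.
by move=> a0; rewrite -eval_tbinomial // eval_laurent_neq0 // tbinomial_neq0.
Qed.

Lemma breadth_unit phi (s : bool) a F : F != 0 ->
  breadth phi ((-1) ^+ s * tmonomial a * F) = breadth phi F.
Proof.
move=> F0; have s0 : (-1) ^+ s != 0 :> ratfun r by rewrite signr_eq0.
rewrite !breadthM ?mulf_neq0 ?tmonomial_neq0 // breadth_tmonomial.
by rewrite /breadth !height_sign !add0r.
Qed.

End Norms.

(** * The Alexander norm *)

Section AlexanderNorm.
Variables (R : realType) (r p q : nat) (G : splice_diagram r p q).
Variable phi : 'rV[R]_r.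

Let l v := linking_vector G v.
Let W v : R := width (newton_polyhedron (tbinomial (l v))) phi.

Lemma width_linking v : W v = `|pairing phi (exponent R (l v))|.
Proof. exact: width_tbinomial. Qed.

Lemma width_boundary i b : adj G (node i) (boundary b) ->
  W (boundary b) = (weight G i (boundary b))%:R^-1 * W (node i).
Proof.
move=> ib; rewrite !width_linking /l (linking_vector_boundary ib).
have w0 : (weight G i (boundary b))%:R != 0 :> R.
  by rewrite pnatr_eq0 -lt0n (leq_trans _ (weight_boundary ib)).
have -> a n : exponent R (a *+ n) = n%:R *: exponent R a.
  by apply/rowP => k; rewrite !mxE mulmxnE rmorphMn /= mulr_natl.
by rewrite pairingZ normrM normr_nat mulKf.
Qed.

(** The double sum runs over the edges between nodes and boundary vertices,
    and there is exactly one such edge for each boundary vertex. *)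
Lemma sum_width_boundary :
  \sum_(b : 'I_q) W (boundary b)
  = \sum_(i < p) (\sum_(b | adj G (node i) (boundary b))
                    (weight G i (boundary b))%:R^-1) * W (node i).
Proof.
under [RHS]eq_bigr do rewrite mulr_suml.
rewrite (exchange_big_dep xpredT) //=; apply: eq_bigr => b _.
have [i ib] := boundary_attached G b.
rewrite (big_pred1 i) => [|j]; first exact: width_boundary.
apply/idP/eqP => [jb|->//]; rewrite adj_sym in jb; rewrite adj_sym in ib.
by have [] := leaf_neighbour (degree_boundary G b) jb ib.
Qed.

(** When the product is nonzero, the exponent collecting the vertices with zero
    linking vector vanishes. The sum can then range over all vertices, since
    the width of t^0 - 1 is zero. *)
Lemma breadth_eisenbud_neumann : eisenbud_neumann G != 0 ->
  breadth phi (eisenbud_neumann G)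
  = (if r == 1%N then width (newton_polyhedron (tbinomial (const_mx 1))) phi
     else 0)
    + \sum_(i < p) (reduced_degree G R i - 2) * W (node i).
Proof.
rewrite /eisenbud_neumann; set S := \sum_(j | _) _.
set A := (if _ then _ else 1).
have -> : tmonomial (0 : 'rV[int]_r) - 1 = 0 by rewrite tmonomial0 subrr.
rewrite exp0rz; case: (S == 0); last by rewrite mulr0z mulr0 mul0r eqxx.
rewrite mulr1z mulr1 mulf_eq0 negb_or => /andP [A0 P0].
rewrite breadthM // breadth_prod => [|j lj]; last first.
  by rewrite expfz_neq0 ?binomial_neq0.
congr (_ + _).
  move: A0; rewrite /A; case: ifP => _; last by rewrite breadth1.
  move=> A0; rewrite breadth_binomial //; apply: contraNneq A0 => ->.
  by rewrite tmonomial0 subrr.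
transitivity (\sum_(j : 'I_p + 'I_q) W (inr j) *~ ((degree G (inr j))%:Z - 2)).
  rewrite [RHS](bigID (fun j => l (inr j) == 0)) /= [X in X + _]big1 ?add0r.
    apply: eq_bigr => j lj.
    by rewrite breadth_exp ?binomial_neq0 ?breadth_binomial.
  move=> j /eqP lj; rewrite width_linking lj /exponent map_mx0 pairing0.
  by rewrite normr0 mul0rz.
rewrite big_sumType /=.
under [X in _ + X]eq_bigr => b _.
  rewrite /degree (degree_boundary G b) -[1%N%:Z - 2]/(-1 : int) mulrN1z; over.
rewrite sumrN [X in _ - X]sum_width_boundary -sumrB; apply: eq_bigr => i _.
rewrite -mulrzr intrB /reduced_degree -pmulrn mulrC -mulrBl; congr (_ * _).
by rewrite addrAC.
Qed.

End AlexanderNorm.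

Theorem corollary4p17 (R : realType) (r p q : nat) (G : splice_diagram r p q)
    (D : laurent r) (D_alexander : is_alexander_polynomial G D)
    (D_neq0 : D != 0) (phi : 'rV[R]_r) :
  [/\ laurent_norm D phi = width (newton_polyhedron D) phi,
      (1 < r)%N ->
        width (newton_polyhedron D) phi
        = \sum_(i < p) (reduced_degree G R i - 2)
            * width (newton_polyhedron
                       (tbinomial (linking_vector G (node i)))) phi,
      r = 1%N ->
        width (newton_polyhedron D) phi
        = width (newton_polyhedron (tbinomial (const_mx 1))) phi
          + \sum_(i < p) (reduced_degree G R i - 2)
              * width (newton_polyhedron
                         (tbinomial (linking_vector G (node i)))) phi
    & \sum_(i < p) (reduced_degree G R i - 2)
        * width (newton_polyhedron
                   (tbinomial (linking_vector G (node i)))) phi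
      = \sum_(i < p) alexander_norm_component G i phi].
Proof.
have [s [a DE]] := D_alexander.
have EN0 : eisenbud_neumann G != 0.
  by have := eval_laurent_neq0 D_neq0; rewrite DE mulf_eq0 negb_or => /andP [].
have DW : width (newton_polyhedron D) phi = breadth phi (eisenbud_neumann G).
  by rewrite width_newton laurent_norm_breadth // DE breadth_unit.
rewrite width_newton in DW *; split=> //.
  by move=> r1; rewrite DW breadth_eisenbud_neumann // gtn_eqF ?add0r.
by move=> /eqP r1; rewrite DW breadth_eisenbud_neumann // r1.
Qed.
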